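(* Let $\mathcal W$ be a Waldhausen category with cylinders and a saturated class of weak equivalences, i.e. weak equivalences are exactly those maps in $\mathcal W$ which become invertible in $\mathrm{Ho}(\mathcal W)$. Then any determinant functor on $\mathcal W$ factors through a derived determinant functor in an essentially unique way. That is, for every Picard groupoid $\mathcal P$ and determinant functor $\det'\colon\mathcal W\to\mathcal P$ there are a derived determinant functor $\det\colon\mathcal W\to\mathcal P$ and an isomorphism $\alpha$ from the determinant functor obtained by precomposing $\det$ with $\mathrm{we}(\mathcal W)\to\mathrm{iso}(\mathrm{Ho}(\mathcal W))$ (with the same additivity data) to $\det'$; and any other such pair $(\det_1,\alpha_1)$ is related to $(\det,\alpha)$ by a unique isomorphism of derived determinant functors $\det\cong\det_1$ compatible with $\alpha,\alpha_1$.
   Context: A Waldhausen category $\mathcal W$ has a chosen zero object $0$, cofibrations $\rightarrowtail$ and weak equivalences (forming the subcategory $\mathrm{we}(\mathcal W)$) in the sense of Waldhausen. It has cylinders if every object $A$ has a cylinder object, i.e. the folding map $A\sqcup A\to A$ factors as a cofibration followed by a weak equivalence. $\mathrm{Ho}(\mathcal W)$ is obtained by formally inverting weak equivalences. A cofiber sequence is $\Delta\colon X\rightarrowtail Y\twoheadrightarrow C^f=0\cup_XY$; $S_2\mathcal W$ is the Waldhausen category of cofiber sequences, with objectwise weak equivalences. A Picard groupoid is a symmetric monoidal groupoid in which tensoring with any object is an equivalence (constraints ass, comm). A determinant functor $\det\colon\mathcal W\to\mathcal P$ is a functor $\mathrm{we}(\mathcal W)\to\mathcal P$ with morphisms $\det(\Delta)\colon\det(C^f)\otimes\det(X)\to\det(Y)$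 for all cofiber sequences $\Delta$ in $\mathcal W$, natural for weak equivalences of cofiber sequences, satisfying: (1) for composable cofibrations $X\xrightarrow fY\xrightarrow gZ$ with compatible cofiber sequences $\Delta_f,\Delta_g,\Delta_{gf}$ and $\widetilde\Delta\colon C^f\rightarrowtail C^{gf}\twoheadrightarrow C^g$ forming a commutative staircase diagram, $\det(\Delta_g)(1\otimes\det(\Delta_f))=\det(\Delta_{gf})(\det(\widetilde\Delta)\otimes1)\circ\mathrm{ass}$; (2) for objects $X,Y$ and cofiber sequences $\Delta_1\colon X\rightarrowtail X\sqcup Y\twoheadrightarrow Y$, $\Delta_2\colon Y\rightarrowtail X\sqcup Y\twoheadrightarrow X$, $\det(\Delta_1)=\det(\Delta_2)\circ\mathrm{comm}$. A derived determinant functor $\det\colon\mathcal W\to\mathcal P$ is a functor $\mathrm{iso}(\mathrm{Ho}(\mathcal W))\to\mathcal P$ with morphisms $\det(\Delta)\colon\det(C^f)\otimes\det(X)\to\det(Y)$ for each cofiber sequence $\Delta\colon X\rightarrowtail Y\twoheadrightarrow C^f$ in $\mathcal W$, natural with respect to isomorphisms in $\mathrm{Ho}(S_2\mathcal W)$, satisfying (1) and (2). Isomorphisms of (derived) determinant functors are natural transformations of the underlying functors compatible with the morphisms $\det(\Delta)$. *)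

(* Defs.v *)
From HB Require Import structures.
From mathcomp Require Import all_boot boolp.

Set Implicit Arguments.
Unset Strict Implicit.
Unset Printing Implicit Defensive.

#[local] Obligation Tactic := idtac.

Declare Scope cat_scope.
Delimit Scope cat_scope with cat.
Local Open Scope cat_scope.
Local Open Scope quotient_scope.

Record category := Category {
  obj :> Type;
  hom : obj -> obj -> Type;
  idm : forall X, hom X X;
  mcomp : forall X Y Z, hom Y Z -> hom X Y -> hom X Z;
  mcomp1m : forall X Y (f : hom X Y), mcomp (idm Y) f = f;
  mcompm1 : forall X Y (f : hom X Y), mcomp f (idm X) = f;
  mcompA : forall X Y Z T (h : hom Z T) (g : hom Y Z) (f : hom X Y),
    mcomp h (mcomp g f) = mcomp (mcomp h g) f }.

Arguments hom {c} X Y.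
Arguments idm {c} X.

Notation "g ∘ f" := (mcomp g f) (at level 40, left associativity) : cat_scope.

Definition is_iso (C : category) (X Y : C) (f : hom X Y) : Prop :=
  exists g : hom Y X, g ∘ f = idm X /\ f ∘ g = idm Y.

Definition morphism_class (C : category) := forall X Y : C, hom X Y -> Prop.

Record functor (C D : category) := Functor {
  fobj :> C -> D;
  fmap : forall X Y, hom X Y -> hom (fobj X) (fobj Y);
  fmap1 : forall X, fmap (idm X) = idm (fobj X);
  fmapM : forall X Y Z (g : hom Y Z) (f : hom X Y),
    fmap (g ∘ f) = fmap g ∘ fmap f }.

Program Definition id_functor (C : category) : functor C C :=
  @Functor C C (fun X => X) (fun X Y f => f) _ _.
Solve Obligations with by [].

Program Definition comp_functor (C D E : category)
    (G : functor D E) (F : functor C D) : functor C E :=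
  @Functor C E (fun X => G (F X)) (fun X Y f => fmap G (fmap F f)) _ _.
Next Obligation. by move=> C D E G F X /=; rewrite !fmap1. Qed.
Next Obligation. by move=> C D E G F X Y Z g f /=; rewrite !fmapM. Qed.

Record nat_trans (C D : category) (F G : functor C D) := NatTrans {
  ntc :> forall X : C, hom (F X) (G X);
  ntcN : forall X Y (f : hom X Y), fmap G f ∘ ntc X = ntc Y ∘ fmap F f }.

Definition is_equivalence (C D : category) (F : functor C D) : Prop :=
  exists (G : functor D C)
         (eta : nat_trans (id_functor C) (comp_functor G F))
         (eps : nat_trans (comp_functor F G) (id_functor D)),
    (forall X, is_iso (eta X)) /\ (forall Y, is_iso (eps Y)).

Definition subcat_closed (C : category) (S : morphism_class C) : Prop :=
  (forall X, S X X (idm X)) /\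
  (forall X Y Z (g : hom Y Z) (f : hom X Y),
     S Y Z g -> S X Y f -> S X Z (g ∘ f)).

Program Definition wide_subcat (C : category) (S : morphism_class C)
    (Scl : subcat_closed S) : category :=
  @Category C (fun X Y => {f : hom X Y | S X Y f})
    (fun X => exist _ (idm X) (proj1 Scl X))
    (fun X Y Z g f => exist _ (proj1_sig g ∘ proj1_sig f)
       (proj2 Scl _ _ _ _ _ (proj2_sig g) (proj2_sig f))) _ _ _.
Next Obligation. by move=> C S Scl X Y [f Sf]; apply: eq_exist; rewrite /= mcomp1m. Qed.
Next Obligation. by move=> C S Scl X Y [f Sf]; apply: eq_exist; rewrite /= mcompm1. Qed.
Next Obligation. by move=> C S Scl X Y Z T h g f; apply: eq_exist; rewrite /= mcompA. Qed.

Lemma iso_subcat_closed (C : category) : subcat_closed (@is_iso C).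
Proof.
split=> [X|X Y Z g f [g' [g'g gg']] [f' [f'f ff']]].
  by exists (idm X); rewrite mcomp1m.
exists (f' ∘ g'); split.
  by rewrite mcompA -(mcompA f' g' g) g'g mcompm1.
by rewrite mcompA -(mcompA g f f') ff' mcompm1.
Qed.

(* The maximal subgroupoid, i.e. iso(C). *)
Definition iso_cat (C : category) : category :=
  wide_subcat (@iso_subcat_closed C).

Lemma is_iso_fmap (C D : category) (F : functor C D) (X Y : C) (f : hom X Y) :
  is_iso f -> is_iso (fmap F f).
Proof.
by case=> g [gf fg]; exists (fmap F g); split; rewrite -fmapM ?gf ?fg fmap1.
Qed.

Program Definition iso_functor (C D : category) (F : functor C D) :
    functor (iso_cat C) (iso_cat D) :=
  @Functor (iso_cat C) (iso_cat D) (fun X => F X)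
    (fun X Y f => exist _ (fmap F (proj1_sig f)) (is_iso_fmap F (proj2_sig f))) _ _.
Next Obligation. by move=> C D F X; apply: eq_exist; rewrite /= fmap1. Qed.
Next Obligation. by move=> C D F X Y Z g f; apply: eq_exist; rewrite /= fmapM. Qed.

Section Localization.
Variables (C : category) (w : morphism_class C).

(* Formal composites of maps of C and of formal inverses of maps in w. *)
Inductive zigzag : C -> C -> Type :=
| zz_map X Y : hom X Y -> zigzag X Y
| zz_inv X Y (s : hom X Y) : w s -> zigzag Y X
| zz_comp X Y Z : zigzag Y Z -> zigzag X Y -> zigzag X Z.

(* The least congruence making zz_comp the composition of a category, with     *)
(* identities the zz_map (idm X), making zz_map a functor and zz_inv s a       *)
(* two-sided inverse of zz_map s.                                              *)
Inductive zz_eq : forall X Y, zigzag X Y -> zigzag X Y -> Prop :=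
| zz_refl X Y (t : zigzag X Y) : zz_eq t t
| zz_sym X Y (t u : zigzag X Y) : zz_eq t u -> zz_eq u t
| zz_trans X Y (t u v : zigzag X Y) : zz_eq t u -> zz_eq u v -> zz_eq t v
| zz_congr X Y Z (t t' : zigzag Y Z) (u u' : zigzag X Y) :
    zz_eq t t' -> zz_eq u u' -> zz_eq (zz_comp t u) (zz_comp t' u')
| zz_1m X Y (t : zigzag X Y) : zz_eq (zz_comp (zz_map (idm Y)) t) t
| zz_m1 X Y (t : zigzag X Y) : zz_eq (zz_comp t (zz_map (idm X))) t
| zz_A X Y Z T (t : zigzag Z T) (u : zigzag Y Z) (v : zigzag X Y) :
    zz_eq (zz_comp t (zz_comp u v)) (zz_comp (zz_comp t u) v)
| zz_mapM X Y Z (g : hom Y Z) (f : hom X Y) :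
    zz_eq (zz_map (g ∘ f)) (zz_comp (zz_map g) (zz_map f))
| zz_invl X Y (s : hom X Y) (ws : w s) :
    zz_eq (zz_comp (zz_inv ws) (zz_map s)) (zz_map (idm X))
| zz_invr X Y (s : hom X Y) (ws : w s) :
    zz_eq (zz_comp (zz_map s) (zz_inv ws)) (zz_map (idm Y)).

HB.instance Definition _ X Y := gen_eqMixin (zigzag X Y).
HB.instance Definition _ X Y := gen_choiceMixin (zigzag X Y).

Definition zz_rel X Y (t u : zigzag X Y) : bool := `[< zz_eq t u >].

Lemma zz_rel_equiv X Y : equiv_class_of (@zz_rel X Y).
Proof.
split=> [t|t u|t u v]; first exact/asboolP/zz_refl.
  by apply/asboolP/asboolP; exact: zz_sym.
by move=> /asboolP tu /asboolP uv; exact/asboolP/(zz_trans tu uv).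
Qed.

Canonical zz_equiv X Y := EquivRelPack (zz_rel_equiv X Y).

Definition ho_hom (X Y : C) : Type := {eq_quot @zz_equiv X Y}.

Definition ho_class X Y (t : zigzag X Y) : ho_hom X Y := \pi_(ho_hom X Y) t.

Definition ho_comp X Y Z (g : ho_hom Y Z) (f : ho_hom X Y) : ho_hom X Z :=
  ho_class (zz_comp (repr g) (repr f)).

Lemma ho_classP X Y (t u : zigzag X Y) : ho_class t = ho_class u <-> zz_eq t u.
Proof.
split=> [/eqmodP/asboolP //|tu]; exact/eqmodP/asboolP.
Qed.

Lemma ho_ind X Y (P : ho_hom X Y -> Prop) :
  (forall t, P (ho_class t)) -> forall f, P f.
Proof. by move=> Pt f; rewrite -[f]reprK; exact: Pt. Qed.

Lemma repr_ho_class X Y (t : zigzag X Y) : zz_eq (repr (ho_class t)) t.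
Proof. by apply/ho_classP; rewrite /ho_class reprK. Qed.

Lemma ho_compE X Y Z (t : zigzag Y Z) (u : zigzag X Y) :
  ho_comp (ho_class t) (ho_class u) = ho_class (zz_comp t u).
Proof. by apply/ho_classP/zz_congr; exact: repr_ho_class. Qed.

Program Definition Ho : category :=
  @Category C ho_hom (fun X => ho_class (zz_map (idm X))) ho_comp _ _ _.
Next Obligation.
move=> X Y; elim/ho_ind=> t; rewrite ho_compE; exact/ho_classP/zz_1m.
Qed.
Next Obligation.
move=> X Y; elim/ho_ind=> t; rewrite ho_compE; exact/ho_classP/zz_m1.
Qed.
Next Obligation.
move=> X Y Z T; elim/ho_ind=> h; elim/ho_ind=> g; elim/ho_ind=> f.
by rewrite !ho_compE; exact/ho_classP/zz_A.
Qed.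

Program Definition loc : functor C Ho :=
  @Functor C Ho (fun X => X) (fun X Y f => ho_class (zz_map f)) _ _.
Next Obligation. by []. Qed.
Next Obligation.
by move=> X Y Z g f /=; rewrite ho_compE; exact/ho_classP/zz_mapM.
Qed.

Lemma loc_iso X Y (s : hom X Y) : w s -> is_iso (fmap loc s).
Proof.
move=> ws; exists (ho_class (zz_inv ws) : @hom Ho Y X); split=> /=.
  by rewrite ho_compE; exact/ho_classP/zz_invl.
by rewrite ho_compE; exact/ho_classP/zz_invr.
Qed.

End Localization.

Section LocalizationFunctor.
Variables (C D : category) (w : morphism_class C) (w' : morphism_class D).
Variables (F : functor C D).
Hypothesis Fw : forall X Y (f : hom X Y), w f -> w' (fmap F f).

Fixpoint zz_fmap X Y (t : zigzag w X Y) : zigzag w' (F X) (F Y) :=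
  match t with
  | zz_map _ _ f => zz_map w' (fmap F f)
  | zz_inv _ _ _ ws => zz_inv (Fw ws)
  | zz_comp _ _ _ t u => zz_comp (zz_fmap t) (zz_fmap u)
  end.

Lemma zz_fmap_eq X Y (t u : zigzag w X Y) :
  zz_eq t u -> zz_eq (zz_fmap t) (zz_fmap u).
Proof.
elim=> {X Y t u} /=.
- by move=> *; exact: zz_refl.
- by move=> X Y t u _; exact: zz_sym.
- by move=> X Y t u v _ tu _; exact: zz_trans tu.
- by move=> *; exact: zz_congr.
- by move=> X Y t; rewrite fmap1; exact: zz_1m.
- by move=> X Y t; rewrite fmap1; exact: zz_m1.
- by move=> *; exact: zz_A.
- by move=> *; rewrite fmapM; exact: zz_mapM.
- by move=> *; rewrite fmap1; exact: zz_invl.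
- by move=> *; rewrite fmap1; exact: zz_invr.
Qed.

Definition Ho_fmap X Y (f : ho_hom w X Y) : ho_hom w' (F X) (F Y) :=
  ho_class (zz_fmap (repr f)).

Lemma Ho_fmapE X Y (t : zigzag w X Y) :
  Ho_fmap (ho_class t) = ho_class (zz_fmap t).
Proof. exact/ho_classP/zz_fmap_eq/repr_ho_class. Qed.

Program Definition Ho_functor : functor (Ho w) (Ho w') :=
  @Functor (Ho w) (Ho w') (fun X => F X) Ho_fmap _ _.
Next Obligation. by move=> X; rewrite [LHS]Ho_fmapE /= fmap1. Qed.
Next Obligation.
move=> X Y Z; elim/ho_ind=> g; elim/ho_ind=> f /=.
by rewrite ho_compE !Ho_fmapE /= ho_compE.
Qed.

End LocalizationFunctor.

Definition is_pushout (C : category) (A B B' D : C) (f : hom A B) (g : hom A B')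
    (h : hom B D) (k : hom B' D) : Prop :=
  h ∘ f = k ∘ g /\
  forall (T : C) (u : hom B T) (v : hom B' T), u ∘ f = v ∘ g ->
    exists! m : hom D T, m ∘ h = u /\ m ∘ k = v.

Definition is_coproduct (C : category) (A B S : C) (i : hom A S) (j : hom B S) :
    Prop :=
  forall (T : C) (u : hom A T) (v : hom B T),
    exists! m : hom S T, m ∘ i = u /\ m ∘ j = v.

Record waldhausen := Waldhausen {
  wcat :> category;
  zero : wcat;
  from0 : forall X : wcat, hom zero X;
  to0 : forall X : wcat, hom X zero;
  from0_uniq : forall X (f : hom zero X), f = from0 X;
  to0_uniq : forall X (f : hom X zero), f = to0 X;
  cof : morphism_class wcat;
  weq : morphism_class wcat;
  cof_iso : forall (X Y : wcat) (f : hom X Y), is_iso f -> cof f;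
  cof_comp : forall (X Y Z : wcat) (g : hom Y Z) (f : hom X Y),
    cof g -> cof f -> cof (g ∘ f);
  weq_iso : forall (X Y : wcat) (f : hom X Y), is_iso f -> weq f;
  weq_comp : forall (X Y Z : wcat) (g : hom Y Z) (f : hom X Y),
    weq g -> weq f -> weq (g ∘ f);
  cof_from0 : forall X, cof (from0 X);
  cof_pushout : forall (A B B' : wcat) (f : hom A B) (g : hom A B'), cof f ->
    exists (D : wcat) (h : hom B D) (k : hom B' D), is_pushout f g h k;
  cof_cobase : forall (A B B' D : wcat) (f : hom A B) (g : hom A B')
      (h : hom B D) (k : hom B' D),
    cof f -> is_pushout f g h k -> cof k;
  weq_gluing : forall (A1 B1 B1' D1 A2 B2 B2' D2 : wcat)
      (f1 : hom A1 B1) (g1 : hom A1 B1') (h1 : hom B1 D1) (k1 : hom B1' D1)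
      (f2 : hom A2 B2) (g2 : hom A2 B2') (h2 : hom B2 D2) (k2 : hom B2' D2)
      (a : hom A1 A2) (b : hom B1 B2) (b' : hom B1' B2') (d : hom D1 D2),
    cof f1 -> cof f2 -> is_pushout f1 g1 h1 k1 -> is_pushout f2 g2 h2 k2 ->
    b ∘ f1 = f2 ∘ a -> b' ∘ g1 = g2 ∘ a ->
    d ∘ h1 = h2 ∘ b -> d ∘ k1 = k2 ∘ b' ->
    weq a -> weq b -> weq b' -> weq d }.

Arguments from0 {w} X.
Arguments to0 {w} X.

Lemma weq_subcat_closed (W : waldhausen) : subcat_closed (@weq W).
Proof.
by split=> [X|X Y Z g f]; [exact/weq_iso/(proj1 (@iso_subcat_closed W))
                          |exact: weq_comp].
Qed.

Definition weW (W : waldhausen) : category :=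
  wide_subcat (@weq_subcat_closed W).

Definition HoW (W : waldhausen) : category := Ho (@weq W).

Definition has_cylinders (W : waldhausen) : Prop :=
  forall (A S : W) (i j : hom A S) (fold : hom S A),
    is_coproduct i j -> fold ∘ i = idm A -> fold ∘ j = idm A ->
    exists (Cyl : W) (k : hom S Cyl) (p : hom Cyl A),
      cof k /\ weq p /\ fold = p ∘ k.

Definition saturated (W : waldhausen) : Prop :=
  forall (X Y : W) (f : hom X Y), weq f <-> is_iso (fmap (loc (@weq W)) f).

Definition is_cofseq (W : waldhausen) (X Y C : W) (f : hom X Y) (q : hom Y C) :
    Prop :=
  cof f /\ is_pushout f (to0 X) q (from0 C).

Section S2.
Variable W : waldhausen.

(* The quotient csC is part of the data: any pushout of 0 <- X -> Y is allowed. *)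
Record cofseq := CofSeq {
  csX : W; csY : W; csC : W;
  csf : hom csX csY;
  csq : hom csY csC;
  cs_ok : is_cofseq csf csq }.

Record cofseq_hom (D E : cofseq) := CofSeqHom {
  homX : hom (csX D) (csX E);
  homY : hom (csY D) (csY E);
  homC : hom (csC D) (csC E);
  homXY : homY ∘ csf D = csf E ∘ homX;
  homYC : homC ∘ csq D = csq E ∘ homY }.

Lemma cofseq_homP D E (u v : cofseq_hom D E) :
  homX u = homX v -> homY u = homY v -> homC u = homC v -> u = v.
Proof.
case: u v => [a b c p q] [a' b' c' p' q'] /= ea eb ec; subst a' b' c'.
by rewrite (Prop_irrelevance p p') (Prop_irrelevance q q').
Qed.

Program Definition cofseq_id D : cofseq_hom D D :=
  @CofSeqHom D D (idm _) (idm _) (idm _) _ _.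
Next Obligation. by move=> D; rewrite /= mcomp1m mcompm1. Qed.
Next Obligation. by move=> D; rewrite /= mcomp1m mcompm1. Qed.

Program Definition cofseq_comp D E G (v : cofseq_hom E G) (u : cofseq_hom D E) :
    cofseq_hom D G :=
  @CofSeqHom D G (homX v ∘ homX u) (homY v ∘ homY u) (homC v ∘ homC u) _ _.
Next Obligation.
by move=> D E G v u; rewrite -mcompA homXY mcompA homXY mcompA.
Qed.
Next Obligation.
by move=> D E G v u; rewrite -mcompA homYC mcompA homYC mcompA.
Qed.

(* Only the category and its weak equivalences are needed to form Ho(S_2 W), so *)
(* the cofibrations of S_2 W are not defined.                                  *)
Program Definition S2 : category :=
  @Category cofseq cofseq_hom cofseq_id cofseq_comp _ _ _.
Next Obligation. by move=> D E u; apply: cofseq_homP; rewrite /= mcomp1m. Qed.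
Next Obligation. by move=> D E u; apply: cofseq_homP; rewrite /= mcompm1. Qed.
Next Obligation.
by move=> D E G H t v u; apply: cofseq_homP; rewrite /= mcompA.
Qed.

Definition S2weq : morphism_class S2 := fun D E (u : cofseq_hom D E) =>
  weq (homX u) /\ weq (homY u) /\ weq (homC u).

Lemma S2weq_subcat_closed : subcat_closed S2weq.
Proof.
have [w1 wM] := @weq_subcat_closed W.
split=> [D|D E G v u [? [? ?]] [? [? ?]]].
  by split; [exact: w1|split; exact: w1].
by split; [exact: wM|split; exact: wM].
Qed.

Definition weS2 : category := wide_subcat S2weq_subcat_closed.

Definition HoS2 : category := Ho S2weq.

Program Definition evX : functor S2 W := @Functor S2 W csX homX _ _.
Solve Obligations with by [].
Program Definition evY : functor S2 W := @Functor S2 W csY homY _ _.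
Solve Obligations with by [].
Program Definition evC : functor S2 W := @Functor S2 W csC homC _ _.
Solve Obligations with by [].

Lemma evX_weq (D E : S2) (u : hom D E) : S2weq u -> weq (fmap evX u).
Proof. by case. Qed.
Lemma evY_weq (D E : S2) (u : hom D E) : S2weq u -> weq (fmap evY u).
Proof. by case=> _ []. Qed.
Lemma evC_weq (D E : S2) (u : hom D E) : S2weq u -> weq (fmap evC u).
Proof. by case=> _ []. Qed.

Definition isoHo_evX : functor (iso_cat HoS2) (iso_cat (HoW W)) :=
  iso_functor (Ho_functor evX_weq).
Definition isoHo_evY : functor (iso_cat HoS2) (iso_cat (HoW W)) :=
  iso_functor (Ho_functor evY_weq).
Definition isoHo_evC : functor (iso_cat HoS2) (iso_cat (HoW W)) :=
  iso_functor (Ho_functor evC_weq).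

Definition we_evX (D E : weS2) (u : hom D E) :
    @hom (weW W) (csX D) (csX E) :=
  exist _ (homX (proj1_sig u)) (evX_weq (proj2_sig u)).
Definition we_evY (D E : weS2) (u : hom D E) :
    @hom (weW W) (csY D) (csY E) :=
  exist _ (homY (proj1_sig u)) (evY_weq (proj2_sig u)).
Definition we_evC (D E : weS2) (u : hom D E) :
    @hom (weW W) (csC D) (csC E) :=
  exist _ (homC (proj1_sig u)) (evC_weq (proj2_sig u)).

Program Definition we_to_isoHo : functor (weW W) (iso_cat (HoW W)) :=
  @Functor (weW W) (iso_cat (HoW W)) (fun X => X)
    (fun X Y s => exist _ (fmap (loc (@weq W)) (proj1_sig s))
                          (loc_iso (proj2_sig s))) _ _.
Next Obligation. by move=> X; apply: eq_exist. Qed.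
Next Obligation.
by move=> X Y Z g f; apply: eq_exist; rewrite /= ho_compE; exact/ho_classP/zz_mapM.
Qed.

End S2.

(* The associator goes from right to left bracketing, cf. det_associativity. *)
Record sym_monoidal := SymMonoidal {
  mcat :> category;
  unit_obj : mcat;
  tens : mcat -> mcat -> mcat;
  tensm : forall A A' B B', hom A A' -> hom B B' -> hom (tens A B) (tens A' B');
  ass : forall A B C, hom (tens A (tens B C)) (tens (tens A B) C);
  lunit : forall A, hom (tens unit_obj A) A;
  runit : forall A, hom (tens A unit_obj) A;
  comm : forall A B, hom (tens A B) (tens B A);
  tensm1 : forall A B, tensm (idm A) (idm B) = idm (tens A B);
  tensmM : forall A A' A'' B B' B'' (f' : hom A' A'') (f : hom A A')
      (g' : hom B' B'') (g : hom B B'),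
    tensm (f' ∘ f) (g' ∘ g) = tensm f' g' ∘ tensm f g;
  ass_iso : forall A B C, is_iso (ass A B C);
  lunit_iso : forall A, is_iso (lunit A);
  runit_iso : forall A, is_iso (runit A);
  assN : forall A A' B B' C C' (f : hom A A') (g : hom B B') (h : hom C C'),
    ass A' B' C' ∘ tensm f (tensm g h) = tensm (tensm f g) h ∘ ass A B C;
  lunitN : forall A A' (f : hom A A'),
    lunit A' ∘ tensm (idm unit_obj) f = f ∘ lunit A;
  runitN : forall A A' (f : hom A A'),
    runit A' ∘ tensm f (idm unit_obj) = f ∘ runit A;
  commN : forall A A' B B' (f : hom A A') (g : hom B B'),
    comm A' B' ∘ tensm f g = tensm g f ∘ comm A B;
  pentagon : forall A B C D,
    ass (tens A B) C D ∘ ass A B (tens C D) =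
    tensm (ass A B C) (idm D) ∘ ass A (tens B C) D ∘ tensm (idm A) (ass B C D);
  triangle : forall A B,
    tensm (runit A) (idm B) ∘ ass A unit_obj B = tensm (idm A) (lunit B);
  comm_sym : forall A B, comm B A ∘ comm A B = idm (tens A B);
  hexagon : forall A B C,
    ass C A B ∘ comm (tens A B) C ∘ ass A B C =
    tensm (comm A C) (idm B) ∘ ass A C B ∘ tensm (idm A) (comm B C) }.

Arguments ass {s} A B C.
Arguments comm {s} A B.

Notation "A ⊗ B" := (tens A B) (at level 40, left associativity) : cat_scope.
Notation "f ⊗ₘ g" := (tensm f g) (at level 40, left associativity) : cat_scope.

Program Definition tens_functor (P : sym_monoidal) (A : P) : functor P P :=
  @Functor P P (fun B => A ⊗ B) (fun B B' g => idm A ⊗ₘ g) _ _.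
Next Obligation. by move=> P A B; exact: tensm1. Qed.
Next Obligation. by move=> P A B B' B'' g' g; rewrite -tensmM mcomp1m. Qed.

Record picard := Picard {
  pcat :> sym_monoidal;
  picard_groupoid : forall (A B : pcat) (f : hom A B), is_iso f;
  picard_equiv : forall A : pcat, is_equivalence (tens_functor A) }.

Section DetAxioms.
Variables (W : waldhausen) (P : picard) (d : W -> P).
Variable dd : forall D : cofseq W, hom (d (csC D) ⊗ d (csX D)) (d (csY D)).

Definition det_associativity : Prop :=
  forall (X Y Z Cf Cg Cgf : W) (f : hom X Y) (g : hom Y Z)
    (qf : hom Y Cf) (qg : hom Z Cg) (qgf : hom Z Cgf)
    (f' : hom Cf Cgf) (g' : hom Cgf Cg)
    (Df : is_cofseq f qf) (Dg : is_cofseq g qg)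
    (Dgf : is_cofseq (g ∘ f) qgf) (D' : is_cofseq f' g'),
    f' ∘ qf = qgf ∘ g -> g' ∘ qgf = qg ->
    dd (CofSeq Dg) ∘ (idm (d Cg) ⊗ₘ dd (CofSeq Df)) =
    dd (CofSeq Dgf) ∘ (dd (CofSeq D') ⊗ₘ idm (d X)) ∘ ass (d Cg) (d Cf) (d X).

(* The composites p ∘ j and q ∘ i vanish because D1 and D2 are cofiber         *)
(* sequences, so p and q are the projections of the coproduct.                 *)
Definition det_commutativity : Prop :=
  forall (X Y S : W) (i : hom X S) (j : hom Y S) (p : hom S X) (q : hom S Y)
    (D1 : is_cofseq i q) (D2 : is_cofseq j p),
    is_coproduct i j -> p ∘ i = idm X -> q ∘ j = idm Y ->
    dd (CofSeq D1) = dd (CofSeq D2) ∘ comm (d Y) (d X).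

End DetAxioms.

Record det_functor (W : waldhausen) (P : picard) := DetFunctor {
  det_fun :> functor (weW W) P;
  det_add : forall D : cofseq W,
    hom (det_fun (csC D) ⊗ det_fun (csX D)) (det_fun (csY D));
  det_nat : forall (D E : weS2 W) (u : hom D E),
    det_add E ∘ (fmap det_fun (we_evC u) ⊗ₘ fmap det_fun (we_evX u)) =
    fmap det_fun (we_evY u) ∘ det_add D;
  det_assoc : @det_associativity W P det_fun det_add;
  det_commut : @det_commutativity W P det_fun det_add }.

Record derived_det_functor (W : waldhausen) (P : picard) := DerivedDetFunctor {
  ddet_fun :> functor (iso_cat (HoW W)) P;
  ddet_add : forall D : cofseq W,
    hom (ddet_fun (csC D) ⊗ ddet_fun (csX D)) (ddet_fun (csY D));
  ddet_nat : forall (D E : iso_cat (HoS2 W)) (u : hom D E),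
    ddet_add E ∘
      (fmap ddet_fun (fmap (isoHo_evC W) u) ⊗ₘ
       fmap ddet_fun (fmap (isoHo_evX W) u)) =
    fmap ddet_fun (fmap (isoHo_evY W) u) ∘ ddet_add D;
  ddet_assoc : @det_associativity W P ddet_fun ddet_add;
  ddet_commut : @det_commutativity W P ddet_fun ddet_add }.

Lemma restrict_det_nat (W : waldhausen) (P : picard)
    (det : derived_det_functor W P) (D E : weS2 W) (u : hom D E) :
  ddet_add det E ∘
    (fmap (comp_functor det (we_to_isoHo W)) (we_evC u) ⊗ₘ
     fmap (comp_functor det (we_to_isoHo W)) (we_evX u)) =
  fmap (comp_functor det (we_to_isoHo W)) (we_evY u) ∘ ddet_add det D.
Proof.
pose v : @hom (iso_cat (HoS2 W)) D E :=
  exist _ (fmap (loc (@S2weq W)) (proj1_sig u)) (loc_iso (proj2_sig u)).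
have vX : fmap (we_to_isoHo W) (we_evX u) = fmap (isoHo_evX W) v.
  by apply: eq_exist; rewrite /= Ho_fmapE.
have vY : fmap (we_to_isoHo W) (we_evY u) = fmap (isoHo_evY W) v.
  by apply: eq_exist; rewrite /= Ho_fmapE.
have vC : fmap (we_to_isoHo W) (we_evC u) = fmap (isoHo_evC W) v.
  by apply: eq_exist; rewrite /= Ho_fmapE.
by have := ddet_nat det v; rewrite -vX -vY -vC.
Qed.

Definition restrict_det (W : waldhausen) (P : picard)
    (det : derived_det_functor W P) : det_functor W P :=
  @DetFunctor W P (comp_functor det (we_to_isoHo W)) (ddet_add det)
    (restrict_det_nat det) (ddet_assoc det) (ddet_commut det).

(* Invertibility of the components is automatic, since P is a groupoid. *)
Record det_iso (W : waldhausen) (P : picard) (det det' : det_functor W P) :=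
  DetIso {
    di_trans :> nat_trans det det';
    di_add : forall D : cofseq W,
      di_trans (csY D) ∘ det_add det D =
      det_add det' D ∘ (di_trans (csC D) ⊗ₘ di_trans (csX D)) }.

Record derived_det_iso (W : waldhausen) (P : picard)
    (det det' : derived_det_functor W P) := DerivedDetIso {
  ddi_trans :> nat_trans det det';
  ddi_add : forall D : cofseq W,
    ddi_trans (csY D) ∘ ddet_add det D =
    ddet_add det' D ∘ (ddi_trans (csC D) ⊗ₘ ddi_trans (csX D)) }.

(* Main.v *)
From mathcomp Require Import all_boot boolp.
Require Import Defs.

Set Implicit Arguments.
Unset Strict Implicit.
Unset Printing Implicit Defensive.

Local Open Scope cat_scope.

(** A determinant functor and a derived one carry the same additivity data, and
    the associativity and commutativity conditions mention only this data and
    the values on objects. So the theorem amounts to two facts: a functor from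
    the weak equivalences to a groupoid extends uniquely to the isomorphisms of
    the homotopy category, and naturality for weak equivalences of cofiber
    sequences implies naturality for isomorphisms of [HoS2 W].

    Both rest on cospans [A -> B' <- B] whose second map [k] is a trivial
    cofibration. A mapping cylinder writes a weak equivalence [s] as [p ∘ i] with
    [i] a cofibration and [p] a retraction of a trivial cofibration [j]. By
    saturation weak equivalences satisfy two out of three, so [i] is trivial as
    well, and [s^-1 = i^-1 ∘ j]. As trivial cofibrations are stable under
    pushout, the maps [k^-1] can be moved to the left of any formal composite,
    and every map of the homotopy category is [k^-1 ∘ u]. If it is invertible
    then [u] is a weak equivalence, again by saturation. This determines the
    extension of a functor [F] on weak equivalences: it must send [k^-1 ∘ u] to
    [F k^-1 ∘ F u].

    To see that this does not depend on the cospan, let zigzags act on cospans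
    out of [A]: a map acts by pushout, the inverse of a trivial cofibration by
    composition with the second map, and a general inverse through
    [s^-1 = i^-1 ∘ j]. Call two cospans linked if they are connected by maps of
    the middle object. Zigzags that are equal in the homotopy category act
    equally up to links ([act_zz_eq]), and a link does not change
    [F k^-1 ∘ F u] ([linked_value]). The value of the extension on a zigzag is
    therefore read off from its action on the identity cospan, and
    multiplicativity follows from [value_act].

    For cofiber sequences only the existence of cospans is needed. The trivial
    cofibrations are those whose latching map is trivial too; they suffice for
    mapping cylinders ([reedy_cylinder]) and can be pushed out
    ([reedy_pushout]). An isomorphism of [HoS2 W] is then [k^-1 ∘ u] with [k] a
    weak equivalence, and [u] is one because its three components become
    invertible in the homotopy category of [W]. Naturality for [k] and [u] gives
    naturality for [k^-1 ∘ u] ([extension_add_nat]). *)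

(** * Isomorphisms *)

Lemma iso_mono (C : category) (X Y Z : C) (f : hom Y Z) (g g' : hom X Y) :
  is_iso f -> f ∘ g = f ∘ g' -> g = g'.
Proof.
by case=> h [hf _] e; rewrite -(mcomp1m g) -hf -mcompA e mcompA hf mcomp1m.
Qed.

Lemma iso_epi (C : category) (X Y Z : C) (f : hom X Y) (g g' : hom Y Z) :
  is_iso f -> g ∘ f = g' ∘ f -> g = g'.
Proof.
by case=> h [_ fh] e; rewrite -(mcompm1 g) -fh mcompA e -mcompA fh mcompm1.
Qed.

Lemma iso_comp (C : category) (X Y Z : C) (g : hom Y Z) (f : hom X Y) :
  is_iso g -> is_iso f -> is_iso (g ∘ f).
Proof. exact: (proj2 (@iso_subcat_closed C)). Qed.

Lemma iso_id (C : category) (X : C) : is_iso (idm X).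
Proof. exact: (proj1 (@iso_subcat_closed C)). Qed.

Lemma iso_cancel_l (C : category) (X Y Z : C) (g : hom Y Z) (f : hom X Y) :
  is_iso g -> is_iso (g ∘ f) -> is_iso f.
Proof.
case=> g' [g'g gg'] [h [hgf gfh]]; exists (h ∘ g).
rewrite -mcompA hgf; split=> //; apply: (@iso_mono _ _ _ _ g).
  by exists g'.
by rewrite !mcompA gfh mcomp1m mcompm1.
Qed.

Lemma iso_cancel_r (C : category) (X Y Z : C) (g : hom Y Z) (f : hom X Y) :
  is_iso f -> is_iso (g ∘ f) -> is_iso g.
Proof.
case=> f' [f'f ff'] [h [hgf gfh]]; exists (f ∘ h).
rewrite mcompA gfh; split=> //; apply: (@iso_epi _ _ _ _ f).
  by exists f'.
by rewrite -!mcompA hgf mcomp1m mcompm1.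
Qed.

(** * Pushouts and coproducts *)

Lemma pushoutC (C : category) (A B B' D : C) (f : hom A B) (g : hom A B')
    (h : hom B D) (k : hom B' D) :
  is_pushout f g h k -> is_pushout g f k h.
Proof.
case=> e U; split=> // T u v /esym/U[m [[mh mk] mU]].
by exists m; split=> // m' [? ?]; apply: mU.
Qed.

Lemma pushout_map (C : category) (A B B' D : C) (f : hom A B) (g : hom A B')
    (h : hom B D) (k : hom B' D) (T : C) (u : hom B T) (v : hom B' T) :
  is_pushout f g h k -> u ∘ f = v ∘ g ->
  exists m : hom D T, m ∘ h = u /\ m ∘ k = v.
Proof. by case=> _ U /U[m [mE _]]; exists m. Qed.

Lemma pushout_ext (C : category) (A B B' D : C) (f : hom A B) (g : hom A B')
    (h : hom B D) (k : hom B' D) (T : C) (m m' : hom D T) :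
  is_pushout f g h k -> m ∘ h = m' ∘ h -> m ∘ k = m' ∘ k -> m = m'.
Proof.
case=> e U eh ek; have /U[n [_ nU]] : m ∘ h ∘ f = m ∘ k ∘ g.
  by rewrite -!mcompA e.
by rewrite -(nU m) // -(nU m').
Qed.

(** Identities count as cofibrations, so this square is the source of the gluing
    lemma when the stability of trivial cofibrations is proved. *)
Lemma pushout_id (C : category) (A B : C) (g : hom A B) :
  is_pushout (idm A) g g (idm B).
Proof.
split=> [|T u v]; first by rewrite mcomp1m mcompm1.
rewrite mcompm1 => ->; exists v; split=> [|m [_ <-]]; last by rewrite mcompm1.
by rewrite mcompm1.
Qed.

Lemma coproduct_ext (C : category) (A B S T : C) (i : hom A S) (j : hom B S)
    (m m' : hom S T) :
  is_coproduct i j -> m ∘ i = m' ∘ i -> m ∘ j = m' ∘ j -> m = m'.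
Proof.
by move=> /(_ T (m ∘ i) (m ∘ j))[n [_ nU]] ei ej; rewrite -(nU m) // -(nU m').
Qed.

(** Coproducts are pushouts over the zero object; this is also why their
    inclusions are cofibrations. *)
Lemma coproduct_exists (W : waldhausen) (A B : W) :
  exists (S : W) (i : hom A S) (j : hom B S),
    [/\ is_coproduct i j, cof i & cof j].
Proof.
have [S [i [j ij]]] := cof_pushout (from0 B) (cof_from0 A).
exists S, i, j; split; last 1 first.
- exact: cof_cobase (cof_from0 A) ij.
- case: ij => _ U T u v; apply: U.
  by rewrite (from0_uniq (u ∘ _)) (from0_uniq (v ∘ _)).
- exact: cof_cobase (cof_from0 B) (pushoutC ij).
Qed.

Section Cofibrations.
Variable W : waldhausen.

Definition triv_cof (X Y : W) (f : hom X Y) : Prop := cof f /\ weq f.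

Lemma triv_cof_id (X : W) : triv_cof (idm X).
Proof. by split; [apply: cof_iso|apply: weq_iso]; exact: iso_id. Qed.

Lemma triv_cof_comp (X Y Z : W) (g : hom Y Z) (f : hom X Y) :
  triv_cof g -> triv_cof f -> triv_cof (g ∘ f).
Proof. by case=> ? ? [? ?]; split; [exact: cof_comp|exact: weq_comp]. Qed.

(** The gluing lemma, applied to the map from the pushout of the identity of [A]
    along [g] to the pushout of [f] along [g]. *)
Lemma triv_cof_cobase (A B B' D : W) (f : hom A B) (g : hom A B')
    (h : hom B D) (k : hom B' D) :
  triv_cof f -> is_pushout f g h k -> triv_cof k.
Proof.
case=> cf wf po; split; first exact: cof_cobase po.
have [[c1 _] [_ w1]] := (triv_cof_id A, triv_cof_id A).
have w1' := (triv_cof_id B').2.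
apply: (weq_gluing (a := idm A) (b := f) (b' := idm B') c1 cf (pushout_id g) po)
  => //; rewrite ?mcompm1 ?mcomp1m //.
exact: esym po.1.
Qed.

Lemma triv_cof_pushout (A B B' : W) (f : hom A B) (g : hom A B') :
  triv_cof f -> exists (D : W) (h : hom B D) (k : hom B' D),
    is_pushout f g h k /\ triv_cof k.
Proof.
move=> tf; have [D [h [k po]]] := cof_pushout g tf.1.
by exists D, h, k; split=> //; exact: triv_cof_cobase po.
Qed.

End Cofibrations.

(** * Mapping cylinders *)

Section Cylinders.
Variable W : waldhausen.
Hypothesis Hcyl : has_cylinders W.
Hypothesis Hsat : saturated W.

Lemma weq_cancel_l (X Y Z : W) (g : hom Y Z) (f : hom X Y) :
  weq g -> weq (g ∘ f) -> weq f.
Proof.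
by move=> /Hsat wg /Hsat; rewrite fmapM => wgf; apply/Hsat/(iso_cancel_l wg).
Qed.

Lemma weq_cancel_r (X Y Z : W) (g : hom Y Z) (f : hom X Y) :
  weq f -> weq (g ∘ f) -> weq g.
Proof.
by move=> /Hsat wf /Hsat; rewrite fmapM => wgf; apply/Hsat/(iso_cancel_r wf).
Qed.

Lemma weq_id (X : W) : weq (idm X).
Proof. exact: (triv_cof_id X).2. Qed.

(** The back end is required to be a trivial cofibration for every [f], while the
    front end is trivial only when [f] is a weak equivalence
    ([cyl_front_triv]). *)
Record mapping_cylinder (A B : W) (f : hom A B) := MappingCylinder {
  cyl : W;
  cyl_front : hom A cyl;
  cyl_proj : hom cyl B;
  cyl_back : hom B cyl;
  cyl_frontE : cyl_proj ∘ cyl_front = f;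
  cyl_backE : cyl_proj ∘ cyl_back = idm B;
  cyl_front_cof : cof cyl_front;
  cyl_proj_weq : weq cyl_proj;
  cyl_back_triv : triv_cof cyl_back }.

(** The cylinder object of [A] is pushed out along [A ⊔ A -> A ⊔ B], so that the
    inclusion of both ends is a cofibration. The same object is the pushout
    along [f] of one end of the cylinder object, a trivial cofibration, which
    makes the back end trivial. *)
Lemma mapping_cylinder_exists (A B : W) (f : hom A B) :
  exists Z : mapping_cylinder f, True.
Proof.
have [S [i0 [i1 [cpS ci0 ci1]]]] := coproduct_exists A A.
have [S' [a [b [cpS' ca cb]]]] := coproduct_exists A B.
have [fold [[fold0 fold1] _]] := cpS A (idm A) (idm A).
have [Z [k [p [ck [wp foldE]]]]] := Hcyl cpS fold0 fold1.
have [t [[t0 t1] _]] := cpS S' a (b ∘ f).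
have [D [h [k' po]]] := cof_pushout t ck.
have ck' : cof k' := cof_cobase ck po.
have [q [[qa qb] _]] := cpS' B f (idm B).
have [pD [pDh pDk']] : exists m, m ∘ h = f ∘ p /\ m ∘ k' = q.
  apply: pushout_map po _; rewrite -mcompA -foldE.
  apply: (coproduct_ext cpS); rewrite -!mcompA ?t0 ?t1 ?fold0 ?fold1 mcompm1 //.
  by rewrite mcompA qb mcomp1m.
have tki1 : triv_cof (k ∘ i1).
  split; first exact: cof_comp.
  by apply: (weq_cancel_l wp); rewrite mcompA -foldE fold1; exact: weq_id.
(* The square of [A -> S -> Z] over [B -> S' -> D], pasted from [po] and the
   evident pushout of [f] along the second inclusion of [S]. *)
have outer : is_pushout (k ∘ i1) f h (k' ∘ b).
  split=> [|T u v uv]; first by rewrite mcompA po.1 -!mcompA t1.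
  have [w [[wa wb] _]] := cpS' T (u ∘ k ∘ i0) v.
  have [m [mh mk']] : exists m, m ∘ h = u /\ m ∘ k' = w.
    apply: pushout_map po _; apply: (coproduct_ext cpS); rewrite -!mcompA.
      by rewrite t0 wa -mcompA.
    by rewrite t1 uv mcompA wb.
  exists m; split; first by rewrite mcompA mk'.
  move=> m' [m'h m'b]; apply: (pushout_ext po); first by rewrite mh.
  apply: (coproduct_ext cpS'); last by rewrite mk' wb -m'b mcompA.
  (* On [A] the map is forced, because [k' ∘ a] factors through [h]. *)
  by rewrite mk' wa -m'h -t0 !mcompA -(mcompA m' k') -po.1 !mcompA.
have tj := triv_cof_cobase tki1 outer.
have pDj : pD ∘ (k' ∘ b) = idm B by rewrite mcompA pDk'.
have wpD : weq pD.
  by apply: (weq_cancel_r tj.2); rewrite pDj; exact: weq_id.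
suff pDi : pD ∘ (k' ∘ a) = f.
  by exists (MappingCylinder pDi pDj (cof_comp ck' ca) wpD tj).
by rewrite mcompA pDk'.
Qed.

Definition chosen_cylinder (A B : W) (f : hom A B) : mapping_cylinder f :=
  sval (cid (mapping_cylinder_exists f)).

Lemma cyl_front_triv (A B : W) (f : hom A B) (Z : mapping_cylinder f) :
  weq f -> triv_cof (cyl_front Z).
Proof.
move=> wf; split; first exact: cyl_front_cof.
by apply: (weq_cancel_l (cyl_proj_weq Z)); rewrite cyl_frontE.
Qed.

End Cylinders.

(** * The homotopy category by cospans *)

Section Cospans.
Variable W : waldhausen.

Record cospan (A B : W) := Cospan {
  apex : W;
  leg : hom A apex;
  tail : hom B apex;
  tail_triv : triv_cof tail }.

(** Being in the same connected component of the category of cospans from [A] to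
    [B]; these components are the maps of the homotopy category. *)
Inductive linked (A B : W) : cospan A B -> cospan A B -> Prop :=
| linked_step (c d : cospan A B) (r : hom (apex c) (apex d)) :
    r ∘ leg c = leg d -> r ∘ tail c = tail d -> linked c d
| linked_sym (c d : cospan A B) : linked c d -> linked d c
| linked_trans (c d e : cospan A B) : linked c d -> linked d e -> linked c e.

Lemma linked_refl (A B : W) (c : cospan A B) : linked c c.
Proof. by apply: (@linked_step _ _ _ _ (idm _)); rewrite mcomp1m. Qed.

Definition cospan_of (A B : W) (f : hom A B) : cospan A B :=
  Cospan f (triv_cof_id B).

Definition is_push (A B C : W) (f : hom B C) (c : cospan A B) (d : cospan A C) :
    Prop :=
  exists h : hom (apex c) (apex d),
    is_pushout (tail c) f h (tail d) /\ leg d = h ∘ leg c.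

Lemma push_exists (A B C : W) (f : hom B C) (c : cospan A B) :
  exists d, is_push f c d.
Proof.
have [D [h [k [po tk]]]] := triv_cof_pushout f (tail_triv c).
by exists (Cospan (h ∘ leg c) tk), h.
Qed.

Definition push (A B C : W) (f : hom B C) (c : cospan A B) : cospan A C :=
  sval (cid (push_exists f c)).

Lemma pushP (A B C : W) (f : hom B C) (c : cospan A B) : is_push f c (push f c).
Proof. exact: svalP (cid (push_exists f c)). Qed.

(** Only the existence half of the universal property enters: a map out of the
    pushout that respects both legs is already a link, so no pushout square has
    to be recognised when pushouts are composed. *)
Lemma push_linked (A B C : W) (f : hom B C) (c : cospan A B) (d : cospan A C)
    (r : hom (apex c) (apex d)) :
  r ∘ tail c = tail d ∘ f -> r ∘ leg c = leg d -> linked (push f c) d.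
Proof.
have [h [po ec]] := pushP f c; move=> /(pushout_map po)[m [mh mk]] er.
by apply: (linked_step (r := m)) => //; rewrite ec mcompA mh.
Qed.

Lemma linked_push (A B C : W) (f : hom B C) (c c' : cospan A B) :
  linked c c' -> linked (push f c) (push f c').
Proof.
elim=> {c c'} [c c' r rl rt|c c' _|c c' c'' _ cc' _]; last 2 first.
- exact: linked_sym.
- exact: linked_trans.
have [h [po ec]] := pushP f c'.
apply: (push_linked (r := h ∘ r)); last by rewrite -mcompA rl.
by rewrite -mcompA rt; exact: po.1.
Qed.

Lemma push_id (A B : W) (c : cospan A B) : linked (push (idm B) c) c.
Proof. by apply: (push_linked (r := idm _)); rewrite mcomp1m ?mcompm1. Qed.

Lemma push_comp (A B C D : W) (g : hom C D) (f : hom B C) (c : cospan A B) :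
  linked (push (g ∘ f) c) (push g (push f c)).
Proof.
have [h [[hE _] ec]] := pushP f c; have [h' [[hE' _] ec']] := pushP g (push f c).
apply: (push_linked (r := h' ∘ h)); last by rewrite -mcompA -ec.
by rewrite -mcompA hE mcompA hE' mcompA.
Qed.

Lemma push_cospan_of (A B C : W) (g : hom B C) (f : hom A B) :
  linked (push g (cospan_of f)) (cospan_of (g ∘ f)).
Proof.
apply: (push_linked (c := cospan_of f) (d := cospan_of (g ∘ f)) (r := g)) => //.
by rewrite mcomp1m mcompm1.
Qed.

Definition pull (A B C : W) (i : hom B C) (ti : triv_cof i) (c : cospan A C) :
    cospan A B :=
  Cospan (leg c) (triv_cof_comp (tail_triv c) ti).

Lemma linked_pull (A B C : W) (i : hom B C) (ti : triv_cof i)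
    (c c' : cospan A C) :
  linked c c' -> linked (pull ti c) (pull ti c').
Proof.
elim=> {c c'} [c c' r rl rt|c c' _|c c' c'' _ cc' _]; last 2 first.
- exact: linked_sym.
- exact: linked_trans.
by apply: (@linked_step _ _ (pull ti c) (pull ti c') r); rewrite //= mcompA rt.
Qed.

(** [push_pull] and [pull_push] together say that a trivial cofibration acts
    bijectively on cospans up to links. *)
Lemma push_pull (A B C : W) (i : hom B C) (ti : triv_cof i) (c : cospan A C) :
  linked (push i (pull ti c)) c.
Proof.
by apply: (push_linked (c := pull ti c) (d := c) (r := idm _)); rewrite mcomp1m.
Qed.

Lemma pull_push (A B C : W) (i : hom B C) (ti : triv_cof i) (c : cospan A B) :
  linked (pull ti (push i c)) c.
Proof.
have [h [po ec]] := pushP i c; apply: linked_sym.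
by apply: (@linked_step _ _ c (pull ti (push i c)) h); rewrite ?ec ?po.1.
Qed.

Hypothesis Hcyl : has_cylinders W.
Hypothesis Hsat : saturated W.

Definition front_triv (X Y : W) (s : hom X Y) (ws : weq s) :
    triv_cof (cyl_front (chosen_cylinder Hcyl Hsat s)) :=
  cyl_front_triv Hsat _ ws.

(** The inverse of [s] acts as [i^-1 ∘ j] for the front end [i] and the back end
    [j] of the mapping cylinder: both are trivial cofibrations, whereas [s] itself
    cannot be used to pull a cospan back. *)
Fixpoint act (A X Y : W) (t : zigzag (@weq W) X Y) :
    cospan A X -> cospan A Y :=
  match t with
  | zz_map _ _ f => push f
  | zz_inv _ _ s ws => fun c =>
      pull (front_triv ws) (push (cyl_back (chosen_cylinder Hcyl Hsat s)) c)
  | zz_comp _ _ _ t u => fun c => act t (act u c)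
  end.

Lemma linked_act (A X Y : W) (t : zigzag (@weq W) X Y) (c c' : cospan A X) :
  linked c c' -> linked (act t c) (act t c').
Proof.
elim: t c c' => {X Y} [X Y f|X Y s ws|X Y Z t IHt u IHu] c c' cc' /=.
- exact: linked_push.
- exact/linked_pull/linked_push.
- exact/IHt/IHu.
Qed.

Lemma act_invr (A X Y : W) (s : hom X Y) (ws : weq s) (c : cospan A Y) :
  linked (push s (act (zz_inv ws) c)) c.
Proof.
rewrite /=; move: (front_triv ws); move: (chosen_cylinder _ _ _) => Z ti.
rewrite -[X in push X _](cyl_frontE Z).
apply: linked_trans (push_comp _ _ _) _.
apply: linked_trans (linked_push _ (push_pull _ _)) _.
apply: linked_trans (linked_sym (push_comp _ _ _)) _.
by rewrite cyl_backE; exact: push_id.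
Qed.

(** Pushing along the projection [p] is inverse up to links to pushing along the back end
    [j]: it is so on one side because [p ∘ j] is an identity, hence on the other
    because [j], a trivial cofibration, acts invertibly. *)
Lemma push_back_proj (A X Y : W) (s : hom X Y) (Z : mapping_cylinder s)
    (c : cospan A (cyl Z)) :
  linked (push (cyl_back Z) (push (cyl_proj Z) c)) c.
Proof.
have tj := cyl_back_triv Z.
have cE := push_pull tj c.
apply: linked_trans (cE).
apply: linked_trans (linked_push _ (linked_push _ (linked_sym cE))) _.
apply: linked_push; apply: linked_trans (linked_sym (push_comp _ _ _)) _.
by rewrite cyl_backE; exact: push_id.
Qed.

Lemma act_invl (A X Y : W) (s : hom X Y) (ws : weq s) (c : cospan A X) :
  linked (act (zz_inv ws) (push s c)) c.
Proof.
rewrite /=; move: (front_triv ws); move: (chosen_cylinder _ _ _) => Z ti.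
rewrite -[X in push X c](cyl_frontE Z).
apply: linked_trans (linked_pull _ (linked_push _ (push_comp _ _ _))) _.
apply: linked_trans (linked_pull _ (push_back_proj _)) _.
exact: pull_push.
Qed.

(** The action of an inverse does not depend on the mapping cylinder: it is
    determined by the action of [s], which [pull] also inverts. *)
Lemma act_inv_pull (A X Y : W) (s : hom X Y) (ws : weq s) (ts : triv_cof s)
    (c : cospan A Y) :
  linked (act (zz_inv ws) c) (pull ts c).
Proof.
apply: linked_trans (act_invl ws _); apply: linked_act.
exact/linked_sym/push_pull.
Qed.

(** This is what makes equality in the homotopy category usable: it turns an
    equality of zigzags into a chain of actual maps between cospans. *)
Lemma act_zz_eq (A X Y : W) (t u : zigzag (@weq W) X Y) (c : cospan A X) :
  zz_eq t u -> linked (act t c) (act u c).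
Proof.
move=> tu; elim: tu c => {X Y t u}.
- by move=> X Y t c; exact: linked_refl.
- by move=> X Y t u _ IH c; exact: linked_sym.
- by move=> X Y t u v _ IH _ IH' c; exact: linked_trans (IH c) (IH' c).
- by move=> X Y Z t t' u u' _ IH _ IH' c; exact: linked_trans (linked_act _ (IH' _)) (IH _).
- by move=> X Y t c; exact: push_id.
- by move=> X Y t c; exact: linked_act (push_id c).
- by move=> X Y Z T t u v c; exact: linked_refl.
- by move=> X Y Z g f c; exact: push_comp.
- by move=> X Y s ws c; exact: linked_trans (act_invl ws c) (linked_sym (push_id c)).
- by move=> X Y s ws c; exact: linked_trans (act_invr ws c) (linked_sym (push_id c)).
Qed.

Notation L := (fmap (loc (@weq W))).

(** [φ] is [tail^-1 ∘ leg] in the homotopy category. *)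
Definition represents (A B : W) (c : cospan A B) (φ : @hom (Ho (@weq W)) A B) : Prop :=
  L (tail c) ∘ φ = L (leg c).

Lemma represents_push (A B C : W) (f : hom B C) (c : cospan A B)
    (φ : @hom (Ho (@weq W)) A B) :
  represents c φ -> represents (push f c) (L f ∘ φ).
Proof.
have [h [po ec]] := pushP f c; rewrite /represents ec => e.
by rewrite mcompA -fmapM -po.1 !fmapM -mcompA e.
Qed.

(** In the homotopy category [s^-1 = i^-1 ∘ j] for the two ends [i], [j] of a
    mapping cylinder of [s]. *)
Lemma cylinder_inverse (X Y : W) (s : hom X Y) (ws : weq s)
    (Z : mapping_cylinder s) :
  L (cyl_front Z) ∘ (ho_class (zz_inv ws) : @hom (Ho (@weq W)) Y X) = L (cyl_back Z).
Proof.
apply: (iso_mono (loc_iso (cyl_proj_weq Z))).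
have pj : L (cyl_proj Z) ∘ L (cyl_back Z) = idm _.
  by rewrite -fmapM cyl_backE fmap1.
rewrite [RHS]pj mcompA -fmapM cyl_frontE /= ho_compE.
exact/ho_classP/zz_invr.
Qed.

(** Acting on the identity cospan thus writes every zigzag as a fraction. *)
Lemma represents_act (A X Y : W) (t : zigzag (@weq W) X Y) (c : cospan A X)
    (φ : @hom (Ho (@weq W)) A X) :
  represents c φ ->
  represents (act t c) ((ho_class t : @hom (Ho (@weq W)) X Y) ∘ φ).
Proof.
elim: t c φ => {X Y} [X Y f|X Y s ws|X Y Z t IHt u IHu] c φ cφ.
- exact: represents_push.
- rewrite [act _ _]/=; move: (front_triv ws) => ti.
  have e := represents_push (cyl_back (chosen_cylinder Hcyl Hsat s)) cφ.
  rewrite /represents -[RHS]e [tail (pull _ _)]/= fmapM -mcompA.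
  by rewrite -(cylinder_inverse ws) -[in RHS]mcompA.
- have -> : ho_class (zz_comp t u) =
    (ho_class t : @hom (Ho (@weq W)) Y Z) ∘ (ho_class u : @hom (Ho (@weq W)) X Y).
    by rewrite /= ho_compE.
  by rewrite -mcompA; apply/IHt/IHu.
Qed.

Lemma represents_id (A : W) : represents (cospan_of (idm A)) (@idm (Ho (@weq W)) A).
Proof. by rewrite /represents mcompm1. Qed.

End Cospans.

(** * Extending functors from weak equivalences to the homotopy category *)

Section Extension.
Variable W : waldhausen.
Hypothesis Hcyl : has_cylinders W.
Hypothesis Hsat : saturated W.
Variables (G : category) (F : functor (weW W) G).
Hypothesis Giso : forall (A B : G) (f : hom A B), is_iso f.

Definition wmap (X Y : W) (s : hom X Y) (ws : weq s) : @hom (weW W) X Y :=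
  exist _ s ws.

Lemma fmap_wmapM (X Y Z : W) (g : hom Y Z) (f : hom X Y) (wg : weq g)
    (wf : weq f) (wgf : weq (g ∘ f)) :
  fmap F (wmap wgf) = fmap F (wmap wg) ∘ fmap F (wmap wf).
Proof. by rewrite -fmapM; congr fmap; apply: eq_exist. Qed.

Lemma fmap_wmap_eq (X Y : W) (f f' : hom X Y) (wf : weq f) (wf' : weq f') :
  f = f' -> fmap F (wmap wf) = fmap F (wmap wf').
Proof. by move=> e; congr fmap; apply: eq_exist. Qed.

(** [v] is [F tail^-1 ∘ F leg]. The relation avoids choosing inverses in [G], and
    it contains the condition that [F] can be applied to the leg. *)
Definition value (A B : W) (c : cospan A B) (v : hom (F A) (F B)) : Prop :=
  exists wl : weq (leg c),
    fmap F (wmap (tail_triv c).2) ∘ v = fmap F (wmap wl).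

Lemma value_exists (A B : W) (c : cospan A B) :
  weq (leg c) -> exists v, value c v.
Proof.
move=> wl; have [t' [_ tt']] := Giso (fmap F (wmap (tail_triv c).2)).
by exists (t' ∘ fmap F (wmap wl)), wl; rewrite mcompA tt' mcomp1m.
Qed.

Lemma value_uniq (A B : W) (c : cospan A B) (v v' : hom (F A) (F B)) :
  value c v -> value c v' -> v = v'.
Proof.
move=> [wl e] [wl' e']; apply: (iso_mono (Giso (fmap F (wmap (tail_triv c).2)))).
by rewrite e e'; exact: fmap_wmap_eq.
Qed.

(** A map [r] of cospans is a weak equivalence, since it commutes with the tails;
    then [F r] cancels from [F tail^-1 ∘ F leg]. *)
Lemma linked_value (A B : W) (c c' : cospan A B) (v : hom (F A) (F B)) :
  linked c c' -> value c v <-> value c' v.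
Proof.
elim=> {c c'} [c c' r rl rt|c c' _ IH|c c' c'' _ IH _ IH']; last 2 first.
- by rewrite IH.
- by rewrite IH IH'.
have wr : weq r.
  apply: (weq_cancel_r Hsat (tail_triv c).2); rewrite rt; exact: (tail_triv c').2.
have tE : fmap F (wmap (tail_triv c').2) =
    fmap F (wmap wr) ∘ fmap F (wmap (tail_triv c).2).
  have w' : weq (r ∘ tail c) by rewrite rt; exact: (tail_triv c').2.
  by rewrite -(fmap_wmapM _ _ w'); exact: fmap_wmap_eq.
have lE (wl : weq (leg c)) (wl' : weq (leg c')) :
    fmap F (wmap wl') = fmap F (wmap wr) ∘ fmap F (wmap wl).
  have w' : weq (r ∘ leg c) by rewrite rl.
  by rewrite -(fmap_wmapM _ _ w'); exact: fmap_wmap_eq.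
split=> [[wl e]|[wl' e]].
  have wl' : weq (leg c') by rewrite -rl; exact: weq_comp.
  by exists wl'; rewrite tE -mcompA e (lE wl).
have wl : weq (leg c) by apply: (weq_cancel_l Hsat wr); rewrite rl.
exists wl; apply: (iso_mono (Giso (fmap F (wmap wr)))).
by rewrite mcompA -tE e (lE wl).
Qed.

Lemma value_cospan_of (A B : W) (f : hom A B) (wf : weq f) :
  value (cospan_of f) (fmap F (wmap wf)).
Proof.
exists wf; rewrite /=.
have -> : wmap (triv_cof_id B).2 = @idm (weW W) B by exact: eq_exist.
by rewrite fmap1 mcomp1m.
Qed.

Lemma value_push (A B C : W) (f : hom B C) (wf : weq f) (c : cospan A B)
    (v : hom (F A) (F B)) :
  value c v -> value (push f c) (fmap F (wmap wf) ∘ v).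
Proof.
have [h [[hE _] ec]] := pushP f c; case=> wl e.
have wtf : weq (tail (push f c) ∘ f) by exact: weq_comp (tail_triv _).2 wf.
have wht : weq (h ∘ tail c) by rewrite hE.
have wh : weq h by exact: weq_cancel_r Hsat _ _ _ _ _ (tail_triv c).2 wht.
have whl : weq (h ∘ leg c) by exact: weq_comp.
have wl' : weq (leg (push f c)) by rewrite ec.
exists wl'; rewrite mcompA -(fmap_wmapM _ _ wtf) (fmap_wmap_eq _ wht (esym hE)).
rewrite (fmap_wmapM wh (tail_triv c).2) -mcompA e -(fmap_wmapM _ _ whl).
exact: fmap_wmap_eq.
Qed.

Lemma value_pull (A B C : W) (i : hom B C) (ti : triv_cof i) (c : cospan A C)
    (v : hom (F A) (F C)) (w : hom (F A) (F B)) :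
  value c v -> fmap F (wmap ti.2) ∘ w = v -> value (pull ti c) w.
Proof.
case=> wl e ew; exists wl; rewrite -e -ew mcompA; congr (_ ∘ _).
exact: fmap_wmapM.
Qed.

Definition normal_form (A B : W) (φ : @hom (Ho (@weq W)) A B) : cospan A B :=
  act Hcyl Hsat (repr φ) (cospan_of (idm A)).

Lemma represents_normal_form (A B : W) (φ : @hom (Ho (@weq W)) A B) :
  represents (normal_form φ) φ.
Proof.
have := represents_act Hcyl Hsat (repr φ) (represents_id A).
by rewrite mcompm1 [ho_class _]reprK.
Qed.

(** By saturation, an isomorphism of the homotopy category is a fraction of weak
    equivalences. *)
Lemma represents_weq (A B : W) (c : cospan A B) (φ : @hom (Ho (@weq W)) A B) :
  represents c φ -> is_iso φ -> weq (leg c).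
Proof.
move=> e iφ; apply/Hsat; rewrite -e; apply: iso_comp iφ.
exact/loc_iso/(tail_triv c).2.
Qed.

Lemma normal_form_linked (A B : W) (t : zigzag (@weq W) A B) :
  linked (normal_form (ho_class t)) (act Hcyl Hsat t (cospan_of (idm A))).
Proof. exact/act_zz_eq/repr_ho_class. Qed.

(** Multiplicativity of the extension. If [t] acts on the identity cospan with
    result [e], then [t] equals [tail^-1 ∘ leg] for the maps of [e], and hence acts
    on [c] as one push along a weak equivalence and one pull, whose effects on
    values are known. *)
Lemma value_act (A B C : W) (c : cospan A B) (v : hom (F A) (F B))
    (t : zigzag (@weq W) B C) (w : hom (F B) (F C)) :
  value c v -> value (act Hcyl Hsat t (cospan_of (idm B))) w ->
  value (act Hcyl Hsat t c) (w ∘ v).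
Proof.
move=> cv; set e := act _ _ _ _ => -[wl ew].
have te := represents_act Hcyl Hsat t (represents_id B).
rewrite mcompm1 -/e in te.
pose u := zz_comp (zz_inv (tail_triv e).2) (zz_map (@weq W) (leg e)).
have tu : zz_eq t u.
  apply/ho_classP; apply: (iso_mono (loc_iso (tail_triv e).2)).
  rewrite te /= !ho_compE; apply/ho_classP.
  apply: zz_trans (zz_sym (zz_A _ _ _)).
  apply: zz_trans (zz_sym (zz_1m _)) _.
  exact/zz_congr/zz_refl/zz_sym/zz_invr.
apply/(linked_value _ (act_zz_eq Hcyl Hsat c tu)).
apply/(linked_value _ (act_inv_pull Hcyl Hsat _ (tail_triv e) _)).
apply: value_pull (value_push wl cv) _.
by rewrite mcompA ew.
Qed.

Lemma extension_value (A B : iso_cat (HoW W)) (φ : hom A B) :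
  exists v, value (normal_form (proj1_sig φ)) v.
Proof.
apply/value_exists/(represents_weq (represents_normal_form _)).
exact: proj2_sig φ.
Qed.

Definition extension_map (A B : iso_cat (HoW W)) (φ : hom A B) :
    hom (F A) (F B) :=
  sval (cid (extension_value φ)).

Lemma extension_mapP (A B : iso_cat (HoW W)) (φ : hom A B) :
  value (normal_form (proj1_sig φ)) (extension_map φ).
Proof. exact: svalP (cid (extension_value φ)). Qed.

Lemma extension_map_we (A B : W) (s : @hom (weW W) A B) :
  extension_map (fmap (we_to_isoHo W) s) = fmap F s.
Proof.
case: s => s ws; apply: (value_uniq (extension_mapP _)).
apply/(linked_value _ (normal_form_linked _)).
apply/(linked_value _ (push_cospan_of _ _)); rewrite mcompm1.
exact: value_cospan_of.
Qed.

Lemma extension_map1 (A : iso_cat (HoW W)) :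
  extension_map (idm A) = idm (F A).
Proof.
rewrite -[LHS]/(extension_map (@idm (iso_cat (HoW W)) A)).
have <- : fmap (we_to_isoHo W) (@idm (weW W) A) = @idm (iso_cat (HoW W)) A.
  exact: fmap1.
by rewrite extension_map_we fmap1.
Qed.

Lemma extension_mapM (A B C : iso_cat (HoW W)) (ψ : hom B C) (φ : hom A B) :
  extension_map (ψ ∘ φ) = extension_map ψ ∘ extension_map φ.
Proof.
apply: (value_uniq (extension_mapP _)).
apply/(linked_value _ (normal_form_linked _)).
exact: (value_act (extension_mapP φ) (extension_mapP ψ)).
Qed.

Definition extension : functor (iso_cat (HoW W)) G :=
  @Functor (iso_cat (HoW W)) G (fun A => F A) extension_map
    extension_map1 extension_mapM.

End Extension.

(** The isomorphisms of the homotopy category are generated by weak equivalences,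
    which gives the uniqueness of extensions. *)
Lemma iso_Ho_cospan (W : waldhausen) (Hcyl : has_cylinders W)
    (Hsat : saturated W) (A B : iso_cat (HoW W)) (φ : hom A B) :
  exists (Z : W) (u : @hom (weW W) A Z) (k : @hom (weW W) B Z),
    fmap (we_to_isoHo W) k ∘ φ = fmap (we_to_isoHo W) u.
Proof.
have e := represents_normal_form Hcyl Hsat (proj1_sig φ).
have wl := represents_weq Hsat e (proj2_sig φ).
exists _, (wmap wl), (wmap (tail_triv (normal_form Hcyl Hsat (proj1_sig φ))).2).
exact: eq_exist.
Qed.

(** * Cospans for cofiber sequences *)

(** The square [m ∘ i = k ∘ v] does not complete [s] and [v] strictly: [s] is
    replaced by [i], and [j] is a section of the weak equivalence relating the
    two. This is enough to have [v ∘ s^-1 = k^-1 ∘ m ∘ j]. *)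
Definition ore_condition (C : category) (w : morphism_class C) : Prop :=
  forall (X Y Z : C) (s : hom X Y) (v : hom X Z), w _ _ s ->
    exists (X' T : C) (i : hom X X') (p : hom X' Y) (j : hom Y X')
           (k : hom Z T) (m : hom X' T),
      [/\ p ∘ i = s, p ∘ j = idm Y, w _ _ p, w _ _ k & m ∘ i = k ∘ v].

Lemma ore_Ho_cospan (C : category) (w : morphism_class C) :
  subcat_closed w -> ore_condition w ->
  forall (X Y : C) (φ : @hom (Ho w) X Y),
    exists (Z : C) (u : hom X Z) (k : hom Y Z),
      w _ _ k /\ fmap (loc w) k ∘ φ = fmap (loc w) u.
Proof.
case=> w1 wM ore X Y; elim/ho_ind=> t.
elim: t => {X Y} [X Y f|X Y s ws|X Y Z t [C1 [v [l [wl IHt]]]] u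
  [B1 [u1 [k [wk IHu]]]]].
- exists Y, f, (idm Y); split; first exact: w1.
  by rewrite fmap1 mcomp1m.
- exists Y, (idm Y), s; split=> //=.
  by rewrite ho_compE; exact/ho_classP/zz_invr.
have [X' [T [i [p [j [k' [m [pi pj wp wk' mi]]]]]]]] := ore _ _ _ k v wk.
exists T, (m ∘ j ∘ u1), (k' ∘ l); split; first exact: wM.
have iE : fmap (loc w) i = fmap (loc w) j ∘ fmap (loc w) k.
  apply: (iso_mono (loc_iso wp)).
  by rewrite mcompA -!fmapM pi pj mcomp1m.
have e : fmap (loc w) k' ∘ fmap (loc w) v =
    fmap (loc w) m ∘ (fmap (loc w) j ∘ fmap (loc w) k).
  by rewrite -iE -!fmapM mi.
have -> : ho_class (zz_comp t u) =
    (ho_class t : @hom (Ho w) Y Z) ∘ (ho_class u : @hom (Ho w) X Y).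
  by rewrite /= ho_compE.
rewrite mcompA [fmap _ (k' ∘ l)]fmapM -(mcompA _ _ (ho_class t : @hom (Ho w) Y Z)).
rewrite IHt [fmap _ k' ∘ _]e.
by rewrite -!mcompA IHu !fmapM.
Qed.

Section CofiberSequences.
Variable W : waldhausen.

Lemma cofseq_exists (X Y : W) (f : hom X Y) :
  cof f -> exists (C : W) (q : hom Y C), is_cofseq f q.
Proof.
move=> cf; have [C [q [k po]]] := cof_pushout (to0 X) cf.
by exists C, q; split=> //; rewrite -(from0_uniq k).
Qed.

Lemma S2_map_exists (D E : S2 W) (a : hom (csX D) (csX E))
    (b : hom (csY D) (csY E)) :
  b ∘ csf D = csf E ∘ a ->
  exists u : @hom (S2 W) D E, homX u = a /\ homY u = b.
Proof.
move=> ab; have [[_ poD] [_ poE]] := (cs_ok D, cs_ok E).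
have [c [cq _]] : exists c, c ∘ csq D = csq E ∘ b /\
    c ∘ from0 (csC D) = from0 (csC E).
  apply: pushout_map poD _.
  by rewrite -mcompA ab mcompA poE.1 -mcompA (to0_uniq (to0 _ ∘ a)).
by exists (CofSeqHom ab cq).
Qed.

Lemma S2_ext (D E : S2 W) (u v : @hom (S2 W) D E) :
  homX u = homX v -> homY u = homY v -> u = v.
Proof.
move=> eX eY; apply: cofseq_homP => //; have [_ po] := cs_ok D.
apply: (pushout_ext po); first by rewrite !homYC eY.
by rewrite (from0_uniq (_ ∘ _)) [RHS]from0_uniq.
Qed.

(** The gluing lemma takes care of the quotients, so that only the underlying
    cofibrations need to be considered below. *)
Lemma S2weqP (D E : S2 W) (u : @hom (S2 W) D E) :
  weq (homX u) -> weq (homY u) -> S2weq u.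
Proof.
move=> wX wY; split=> //; split=> //.
have [[cD poD] [cE poE]] := (cs_ok D, cs_ok E).
apply: (weq_gluing cD cE poD poE (homXY u) _ (homYC u)) (wX) (wY)
  (triv_cof_id (zero W)).2.
  by rewrite (to0_uniq (_ ∘ _)) [RHS]to0_uniq.
by rewrite (from0_uniq (_ ∘ _)) [RHS]from0_uniq.
Qed.

(** Here [m] is the latching map from the pushout of the subobject of [E] and the
    total object of [D]. It must be a cofibration for the pushout of [i] along any
    map to be again a cofiber sequence. *)
Definition reedy_triv_cof (D E : S2 W) (i : @hom (S2 W) D E) : Prop :=
  triv_cof (homX i) /\
  exists (Q : W) (a : hom (csX E) Q) (b : hom (csY D) Q) (m : hom Q (csY E)),
    [/\ is_pushout (homX i) (csf D) a b, triv_cof m, m ∘ a = csf E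
      & m ∘ b = homY i].

(** On total objects the pushout is taken in two steps: [N] adjoins the new
    subobject to the total object of [G], and then the latching map of [i] is
    pushed out. Both steps preserve cofibrations, so the inclusion [y2 ∘ n1] of
    the new subobject is one. *)
Lemma reedy_pushout (E D G : S2 W) (i : @hom (S2 W) E D)
    (u : @hom (S2 W) E G) :
  reedy_triv_cof i ->
  exists (H : S2 W) (k : @hom (S2 W) G H) (m : @hom (S2 W) D H),
    S2weq k /\ m ∘ i = k ∘ u.
Proof.
case=> ti [Q [a [b [l [poQ tl la lb]]]]].
have [X' [h [kX [poX tkX]]]] := triv_cof_pushout (homX u) ti.
have [N [n1 [n2 [poN tn2]]]] := triv_cof_pushout (csf G) tkX.
have cn1 : cof n1 := cof_cobase (cs_ok G).1 (pushoutC poN).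
have [w [wa wb]] : exists w, w ∘ a = n1 ∘ h /\ w ∘ b = n2 ∘ homY u.
  apply: pushout_map poQ _.
  by rewrite -!mcompA homXY poX.1 !mcompA poN.1.
have [Y' [y1 [y2 [poY ty2]]]] := triv_cof_pushout w tl.
have cf : cof (y2 ∘ n1) by exact: cof_comp ty2.1 cn1.
have [C' [q' Hq]] := cofseq_exists cf.
pose H : S2 W := CofSeq Hq.
have [k [kXE kYE]] : exists k : @hom (S2 W) G H,
    homX k = kX /\ homY k = y2 ∘ n2.
  by apply: S2_map_exists; rewrite /= -!mcompA poN.1.
have [m [mX mY]] : exists m : @hom (S2 W) D H, homX m = h /\ homY m = y1.
  by apply: S2_map_exists; rewrite /= -la mcompA poY.1 -!mcompA wa.
exists H, k, m; split.
  by apply: S2weqP; rewrite ?kXE ?kYE; [exact: tkX.2|exact: weq_comp ty2.2 tn2.2].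
apply: S2_ext; rewrite /= ?mX ?kXE ?mY ?kYE; first exact: poX.1.
by rewrite -lb mcompA poY.1 -!mcompA wb.
Qed.

Hypothesis Hcyl : has_cylinders W.
Hypothesis Hsat : saturated W.

(** The mapping cylinder on subobjects is [Z]. On total objects [M] glues the
    total objects of [E] and [D] to the two ends of [Z], and the map from [M] to
    the total object of [D] is factored as a cofibration and a weak
    equivalence. *)
Lemma reedy_cylinder (E D : S2 W) (s : @hom (S2 W) E D) :
  S2weq s ->
  exists (Z : S2 W) (i : @hom (S2 W) E Z) (p : @hom (S2 W) Z D)
         (j : @hom (S2 W) D Z),
    [/\ reedy_triv_cof i, p ∘ i = s, p ∘ j = idm D & S2weq p].
Proof.
move=> [wX [wY _]].
have [Z _] := mapping_cylinder_exists Hcyl Hsat (homX s).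
have ti := cyl_front_triv Hsat Z wX.
have [Q [a [b [poQ tb]]]] := triv_cof_pushout (csf E) ti.
have ca : cof a := cof_cobase (cs_ok E).1 (pushoutC poQ).
have [M [c [d poM]]] := cof_pushout (a ∘ cyl_back Z) (cs_ok D).1.
have cd : cof d := cof_cobase (cs_ok D).1 poM.
have [q [qa qb]] : exists q, q ∘ a = csf D ∘ cyl_proj Z /\ q ∘ b = homY s.
  by apply: pushout_map poQ _; rewrite -mcompA cyl_frontE homXY.
have [r [rc rd]] : exists r, r ∘ c = idm (csY D) /\ r ∘ d = q.
  apply: pushout_map poM _.
  by rewrite mcompA qa -mcompA cyl_backE mcomp1m mcompm1.
have [V _] := mapping_cylinder_exists Hcyl Hsat r.
have cm : cof (cyl_front V ∘ d) by exact: cof_comp (cyl_front_cof V) cd.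
have cf : cof (cyl_front V ∘ d ∘ a) by exact: cof_comp.
have [C' [q' Hq]] := cofseq_exists cf.
pose Z2 : S2 W := CofSeq Hq.
have pm : cyl_proj V ∘ (cyl_front V ∘ d) = q by rewrite mcompA cyl_frontE.
have [p [pX pY]] : exists p : @hom (S2 W) Z2 D,
    homX p = cyl_proj Z /\ homY p = cyl_proj V.
  by apply: S2_map_exists; rewrite /= mcompA pm.
have [i [iX iY]] : exists i : @hom (S2 W) E Z2,
    homX i = cyl_front Z /\ homY i = cyl_front V ∘ d ∘ b.
  by apply: S2_map_exists; rewrite /= -[RHS]mcompA poQ.1 mcompA.
have [j [jX jY]] : exists j : @hom (S2 W) D Z2,
    homX j = cyl_back Z /\ homY j = cyl_front V ∘ c.
  by apply: S2_map_exists; rewrite /= -!mcompA poM.1.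
exists Z2, i, p, j; split.
- split; first by rewrite iX.
  exists Q, a, b, (cyl_front V ∘ d); split; rewrite ?iX ?iY //; split=> //.
  apply: (weq_cancel_r Hsat tb.2).
  by apply: (weq_cancel_l Hsat (cyl_proj_weq V)); rewrite mcompA pm qb.
- apply: S2_ext; rewrite /= ?pX ?pY ?iX ?iY; first exact: cyl_frontE.
  by rewrite mcompA pm.
- apply: S2_ext; rewrite /= ?pX ?pY ?jX ?jY; first exact: cyl_backE.
  by rewrite mcompA cyl_frontE.
- by apply: S2weqP; rewrite ?pX ?pY; exact: cyl_proj_weq.
Qed.

Lemma S2_ore : ore_condition (@S2weq W).
Proof.
move=> X Y Z s v /reedy_cylinder[X' [i [p [j [ti pi pj wp]]]]].
have [T [k [m [wk mi]]]] := reedy_pushout v ti.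
by exists X', T, i, p, j, k, m.
Qed.

Notation L2 := (loc (@S2weq W)).

Lemma weq_of_Ho_functor (C : category) (w : morphism_class C)
    (ev : functor C W) (evw : forall X Y (f : hom X Y), w _ _ f -> weq (fmap ev f))
    (X Y : C) (f : hom X Y) :
  is_iso (fmap (loc w) f) -> weq (fmap ev f).
Proof.
by move=> /(is_iso_fmap (Ho_functor evw)); rewrite /= Ho_fmapE => /Hsat.
Qed.

Lemma iso_HoS2_cospan (D E : iso_cat (HoS2 W)) (φ : hom D E) :
  exists (G : weS2 W) (u : @hom (weS2 W) D G) (k : @hom (weS2 W) E G),
    fmap L2 (proj1_sig k) ∘ proj1_sig φ = fmap L2 (proj1_sig u).
Proof.
have [G [u [k [wk e]]]] :=
  ore_Ho_cospan (@S2weq_subcat_closed W) S2_ore (proj1_sig φ).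
have iu : is_iso (fmap L2 u).
  by rewrite -e; apply: iso_comp (loc_iso wk) (proj2_sig φ).
have wu : S2weq u.
  split; first exact: (weq_of_Ho_functor (@evX_weq W) iu).
  split; first exact: (weq_of_Ho_functor (@evY_weq W) iu).
  exact: (weq_of_Ho_functor (@evC_weq W) iu).
by exists G, (exist _ u wu), (exist _ k wk).
Qed.

End CofiberSequences.

(** * Derived determinant functors *)

Section Derived.
Variables (W : waldhausen) (P : picard).
Hypothesis Hcyl : has_cylinders W.
Hypothesis Hsat : saturated W.

(** With [k ∘ φ = u] for weak equivalences [k] and [u] of cofiber sequences,
    the naturality squares of [k] and [u] differ by that of [φ], and [det k] can
    be cancelled. *)
Lemma extension_add_nat (det : det_functor W P)
    (Fd := extension Hcyl Hsat det (@picard_groupoid P))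
    (D E : iso_cat (HoS2 W)) (φ : hom D E) :
  det_add det E ∘
    (fmap Fd (fmap (isoHo_evC W) φ) ⊗ₘ fmap Fd (fmap (isoHo_evX W) φ)) =
  fmap Fd (fmap (isoHo_evY W) φ) ∘ det_add det D.
Proof.
have [G [u [k e]]] := iso_HoS2_cospan Hcyl Hsat φ.
have FdE (A B : W) (s : @hom (weW W) A B) : fmap Fd (fmap (we_to_isoHo W) s) = fmap det s.
  exact: extension_map_we.
pose loc2 (X Y : weS2 W) (s : hom X Y) : @hom (iso_cat (HoS2 W)) X Y :=
  exist _ (fmap (loc (@S2weq W)) (proj1_sig s)) (loc_iso (proj2_sig s)).
have e2 : loc2 _ _ k ∘ φ = loc2 _ _ u by exact: eq_exist.
have vX X Y (s : @hom (weS2 W) X Y) :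
    fmap (isoHo_evX W) (loc2 _ _ s) = fmap (we_to_isoHo W) (we_evX s).
  by apply: eq_exist; rewrite /= Ho_fmapE.
have vY X Y (s : @hom (weS2 W) X Y) :
    fmap (isoHo_evY W) (loc2 _ _ s) = fmap (we_to_isoHo W) (we_evY s).
  by apply: eq_exist; rewrite /= Ho_fmapE.
have vC X Y (s : @hom (weS2 W) X Y) :
    fmap (isoHo_evC W) (loc2 _ _ s) = fmap (we_to_isoHo W) (we_evC s).
  by apply: eq_exist; rewrite /= Ho_fmapE.
have uX : fmap det (we_evX u) = fmap det (we_evX k) ∘ fmap Fd (fmap (isoHo_evX W) φ).
  by rewrite -!FdE -!vX -e2 !fmapM.
have uY : fmap det (we_evY u) = fmap det (we_evY k) ∘ fmap Fd (fmap (isoHo_evY W) φ).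
  by rewrite -!FdE -!vY -e2 !fmapM.
have uC : fmap det (we_evC u) = fmap det (we_evC k) ∘ fmap Fd (fmap (isoHo_evC W) φ).
  by rewrite -!FdE -!vC -e2 !fmapM.
apply: (iso_mono (picard_groupoid (fmap det (we_evY k)))).
rewrite !mcompA -uY -(det_nat det u) -(det_nat det k) uX uC tensmM.
exact/esym/mcompA.
Qed.

Definition derived_det (det : det_functor W P) : derived_det_functor W P :=
  @DerivedDetFunctor W P (extension Hcyl Hsat det (@picard_groupoid P))
    (det_add det) (extension_add_nat det) (det_assoc det) (det_commut det).

Lemma derived_det_restrict_nat (det : det_functor W P) (X Y : weW W)
    (s : hom X Y) :
  fmap det s ∘ idm (det X) =
  idm (det Y) ∘ fmap (restrict_det (derived_det det)) s.
Proof.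
rewrite mcomp1m mcompm1; exact/esym/extension_map_we.
Qed.

Lemma derived_det_restrict_add (det : det_functor W P) (D : cofseq W) :
  idm (det (csY D)) ∘ det_add (restrict_det (derived_det det)) D =
  det_add det D ∘ (idm (det (csC D)) ⊗ₘ idm (det (csX D))).
Proof. by rewrite tensm1 mcompm1 mcomp1m. Qed.

Definition derived_det_restrict (det : det_functor W P) :
    det_iso (restrict_det (derived_det det)) det :=
  @DetIso W P (restrict_det (derived_det det)) det
    (@NatTrans _ _ (restrict_det (derived_det det)) det
       (fun X => idm (det X)) (@derived_det_restrict_nat det))
    (derived_det_restrict_add det).

Lemma derived_det_iso_ext (det det1 : derived_det_functor W P)
    (β β' : derived_det_iso det det1) :
  (forall X, β X = β' X) -> β = β'.
Proof.
case: β β' => [[b bN] ba] [[b' bN'] ba'] /= e.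
have {}e : b = b' by apply: functional_extensionality_dep.
by subst b'; rewrite (Prop_irrelevance bN' bN) in ba' *; rewrite (Prop_irrelevance ba' ba).
Qed.

Lemma we_components_natural (F F1 : functor (iso_cat (HoW W)) P)
    (b : forall X : W, hom (F X) (F1 X)) :
  (forall (X Y : W) (s : @hom (weW W) X Y),
     fmap F1 (fmap (we_to_isoHo W) s) ∘ b X =
     b Y ∘ fmap F (fmap (we_to_isoHo W) s)) ->
  forall (X Y : iso_cat (HoW W)) (φ : hom X Y),
    fmap F1 φ ∘ b X = b Y ∘ fmap F φ.
Proof.
move=> bN X Y φ; have [Z [u [k e]]] := iso_Ho_cospan Hcyl Hsat φ.
apply: (iso_mono (picard_groupoid (fmap F1 (fmap (we_to_isoHo W) k)))).
by rewrite !mcompA bN -fmapM e bN -mcompA -fmapM e.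
Qed.

(** Naturality on all isomorphisms of the homotopy category follows from that on
    weak equivalences by writing them as fractions; compatibility with the
    additivity data is the same condition on both sides. *)
Lemma restrict_det_full (det det1 : derived_det_functor W P)
    (γ : det_iso (restrict_det det) (restrict_det det1)) :
  exists β : derived_det_iso det det1, forall X : W, β X = γ X.
Proof.
pose b := @NatTrans _ _ det det1 γ (we_components_natural (ntcN γ)).
by exists (@DerivedDetIso W P det det1 b (di_add γ)).
Qed.

End Derived.

(** Componentwise [γ] is [α1^-1 ∘ α]. *)
Lemma det_iso_quotient (W : waldhausen) (P : picard)
    (det det1 det' : det_functor W P) (α : det_iso det det')
    (α1 : det_iso det1 det') :
  exists γ : det_iso det det1, forall X : W, α X = α1 X ∘ γ X.
Proof.
have ex (X : W) : exists g : hom (det X) (det1 X), α1 X ∘ g = α X.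
  have [a [_ aK]] := picard_groupoid (α1 X).
  by exists (a ∘ α X); rewrite mcompA aK mcomp1m.
pose g X := sval (cid (ex X)); have gE X : α1 X ∘ g X = α X := svalP (cid (ex X)).
have gN X Y (s : @hom (weW W) X Y) : fmap det1 s ∘ g X = g Y ∘ fmap det s.
  apply: (iso_mono (picard_groupoid (α1 Y))).
  by rewrite !mcompA -ntcN gE -mcompA gE ntcN.
have gA (D : cofseq W) : g (csY D) ∘ det_add det D =
    det_add det1 D ∘ (g (csC D) ⊗ₘ g (csX D)).
  apply: (iso_mono (picard_groupoid (α1 (csY D)))).
  by rewrite !mcompA gE !di_add -mcompA -tensmM !gE.
exists (@DetIso W P det det1 (@NatTrans _ _ det det1 g gN) gA) => X /=.
by rewrite gE.
Qed.

Theorem corollary2p1p2 (W : waldhausen) (Hcyl : has_cylinders W)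
    (Hsat : saturated W) (P : picard) (det' : det_functor W P) :
  exists (det : derived_det_functor W P) (alpha : det_iso (restrict_det det) det'),
    forall (det1 : derived_det_functor W P) (alpha1 : det_iso (restrict_det det1) det'),
      exists! beta : derived_det_iso det det1,
        forall X : W, alpha X = alpha1 X ∘ beta X.
Proof.
exists (derived_det Hcyl Hsat det').
exists (derived_det_restrict Hcyl Hsat det').
move=> det1 alpha1.
have [γ γE] := det_iso_quotient (derived_det_restrict Hcyl Hsat det') alpha1.
have [β βE] := restrict_det_full Hcyl Hsat γ.
exists β; split=> [X|β' β'E]; first by rewrite βE.
apply: derived_det_iso_ext => X.
apply: (iso_mono (picard_groupoid (alpha1 X))).
by rewrite -β'E βE γE.
Qed.
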